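(* Let $G$ be a finite group. The nontrivial Smith invariant factors of the commuting difference lattice $M_{\mathrm{comm}}(G)$, and hence the conductor $C_{\mathrm{comm}}(G)$, depend only on the isoclinism class of $G$. That is, if $G$ and $H$ are isoclinic finite groups, then $M_{\mathrm{comm}}(G)$ and $M_{\mathrm{comm}}(H)$ have the same nontrivial invariant factors, and $C_{\mathrm{comm}}(G)=C_{\mathrm{comm}}(H)$.
   Context: Commuting difference lattice: for a finite group $G$ let $P$ be the $G\times G$ zero-one matrix with $P_{g,h}=1$ if $gh=hg$ and $P_{g,h}=0$ otherwise. Then $M_{\mathrm{comm}}(G)\subseteq\mathbb{Z}^{G}$ is the $\mathbb{Z}$-span of all differences of rows $P_g-P_{g'}$, $g,g'\in G$. The invariant factors of a lattice $M\subseteq\mathbb{Z}^N$ are the nonzero Smith normal form entries $d_1\mid\cdots\mid d_r$ of any integer matrix whose rows generate $M$; the nontrivial ones are those greater than $1$ (listed with multiplicity). The commuting conductor is the set of primes $C_{\mathrm{comm}}(G)=\{p \text{ prime}:\operatorname{rank}_{\mathbb{F}_p}(M_{\mathrm{comm}}(G)\bmod p)<\operatorname{rank}_{\mathbb{Q}}M_{\mathrm{comm}}(G)\}$. An isoclinism from $G$ to $H$ is a pair of isomorphisms $\alpha:G/Z(G)\to H/Z(H)$ and $\beta:G'\to H'$ (derived subgroups) compatible with the commutator pairings: whenever $\alpha(g_iZ(G))=h_iZ(H)$ for $i=1,2$, one has $\beta([g_1,g_2])=[h_1,h_2]$. Groups are isoclinic if an isoclinism between them exists. *)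

(* Defs.v *)
From mathcomp Require Import all_boot all_order all_fingroup all_algebra all_solvable.

Set Implicit Arguments.
Unset Strict Implicit.
Unset Printing Implicit Defensive.

Import Order.TTheory GRing.Theory Num.Theory.
Local Open Scope ring_scope.

(* A lattice in Z^N is given by its membership predicate. *)
Definition generates (m N : nat) (A : 'M[int]_(m, N))
    (M : 'rV[int]_N -> Prop) : Prop :=
  forall v, M v <-> exists u : 'rV[int]_m, v = u *m A.

Definition smith_mx (m n : nat) (d : seq nat) : 'M[int]_(m, n) :=
  \matrix_(i, j) ((nth 0%N d i)%:Z *+ (i == j :> nat)).

(* d lists only the nonzero Smith entries of A: past the end of d, nth
   returns 0, and the size bound makes every entry of d occur in smith_mx. *)
Definition smith_factors (m n : nat) (A : 'M[int]_(m, n)) (d : seq nat) : Prop :=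
  [/\ sorted dvdn d, all (ltn 0) d, (size d <= minn m n)%N
    & exists L : 'M[int]_m, exists R : 'M[int]_n,
        [/\ L \in unitmx, R \in unitmx & A = L *m smith_mx m n d *m R]].

Definition invariant_factors (N : nat) (M : 'rV[int]_N -> Prop)
    (d : seq nat) : Prop :=
  exists m (A : 'M[int]_(m, N)), generates A M /\ smith_factors A d.

Definition nontrivial (d : seq nat) : seq nat := [seq x <- d | (1 < x)%N].

(* The dimension of the F-span of the image of M in F^N; it does not depend on
   the generating matrix A. *)
Definition lattice_rank (F : fieldType) (N : nat) (M : 'rV[int]_N -> Prop)
    (r : nat) : Prop :=
  exists m (A : 'M[int]_(m, N)),
    generates A M /\ r = \rank (map_mx (fun z : int => z%:~R : F) A).

Definition conductor (N : nat) (M : 'rV[int]_N -> Prop) (p : nat) : Prop :=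
  prime p /\
  exists r s, [/\ lattice_rank 'F_p M r, lattice_rank rat M s & (r < s)%N].

(* Z^G is realised as 'rV[int]_#|G| through the enumeration enum_val of G. *)
Definition comm_mx01 (gT : finGroupType) (G : {group gT}) : 'M[int]_#|G| :=
  \matrix_(i, j)
    (enum_val i * enum_val j == enum_val j * enum_val i)%g%:Z.

Definition comm_lattice (gT : finGroupType) (G : {group gT})
    (v : 'rV[int]_#|G|) : Prop :=
  exists c : 'M[int]_#|G|,
    v = \sum_i \sum_j c i j *: (row i (comm_mx01 G) - row j (comm_mx01 G)).
Arguments comm_lattice {gT} G v.

(* [~ x, y] is x^-1 * y^-1 * x * y; the convention x * y * x^-1 * y^-1 gives the
   same notion, since the compatibility is required for all representatives. *)
Definition isoclinism (gT hT : finGroupType) (G : {group gT}) (H : {group hT})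
    (alpha : {morphism (G / 'Z(G))%g >-> coset_of 'Z(H)})
    (beta : {morphism (G^`(1))%g >-> hT}) : Prop :=
  [/\ isom (G / 'Z(G))%g (H / 'Z(H))%g alpha,
      isom (G^`(1))%g (H^`(1))%g beta
    & forall g1 g2 h1 h2, g1 \in G -> g2 \in G -> h1 \in H -> h2 \in H ->
        alpha (coset 'Z(G) g1) = coset 'Z(H) h1 ->
        alpha (coset 'Z(G) g2) = coset 'Z(H) h2 ->
        beta [~ g1, g2]%g = [~ h1, h2]%g].

Definition isoclinic (gT hT : finGroupType) (G : {group gT})
    (H : {group hT}) : Prop :=
  exists alpha beta, @isoclinism gT hT G H alpha beta.

Lemma smith_factors_exist m n (A : 'M[int]_(m, n)) :
  exists d, smith_factors A d.
Proof.
have [L Lu [R Ru [d dS ->]]] := int_Smith_normal_form A.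
pose e := [seq `|x|%N | x <- take (minn m n) d].
have eS : sorted dvdn e.
  rewrite /e sorted_map; apply: (subseq_sorted _ (take_subseq _ _)) => //.
  by move=> y x z; exact: dvdn_trans.
have filtE s i : sorted dvdn s -> nth 0%N (filter (ltn 0) s) i = nth 0%N s i.
  elim: s i => //= x s IHs i xs; case: ltnP => [_|]; last first.
    rewrite leqn0 => /eqP x0; have : all (dvdn x) s.
      by rewrite (order_path_min _ xs) // => ? ? ?; exact: dvdn_trans.
    rewrite {xs IHs}x0 => s0.
    have -> : filter (ltn 0) s = [::].
      elim: s s0 => //= y s IHs /andP[+ /IHs->].
      by rewrite dvd0n => /eqP->.
    rewrite nth_nil; case: i => //= i.
    have [?|?] := ltnP i (size s); last by rewrite nth_default.
    have /all_nthP s0i := s0.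
    by have := s0i 0%N i; rewrite dvd0n => /(_ _)/eqP->.
  by case: i => //= i; rewrite IHs // (path_sorted xs).
exists (filter (ltn 0) e); split.
- by apply: sorted_filter => // y x z; exact: dvdn_trans.
- exact: filter_all.
- by rewrite (leq_trans (size_subseq (filter_subseq _ _))) // size_map size_take_min geq_minl.
pose sg (x : int) : int := if (x < 0)%R then -1 else 1.
have sgE x : x = sg x * `|x|%N%:Z.
  by rewrite /sg abszE; case: ltrP => ?; [rewrite ltr0_norm ?mulN1r ?opprK | rewrite ger0_norm ?mul1r].
exists (L *m diag_mx (\row_i sg d`_i)), R; split=> //.
  rewrite unitmx_mul Lu unitmxE det_diag rpred_prod // => i _.
  by rewrite mxE /sg; case: ifP.
congr (_ *m R); rewrite -mulmxA; congr (L *m _).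
apply/matrixP => i j; rewrite mul_diag_mx !mxE.
case: eqP => [ij|_]; last by rewrite !mulr0n mulr0.
rewrite !mulr1n filtE // [LHS]sgE; congr (_ * _).
have im : (i < minn m n)%N by rewrite leq_min ltn_ord ij ltn_ord.
rewrite /e; have [id|di] := ltnP i (size d).
  by rewrite (nth_map 0) ?nth_take // size_take; case: ifP.
by rewrite !nth_default // size_map size_take_min geq_min di orbT.
Qed.

Lemma comm_lattice_generated (gT : finGroupType) (G : {group gT}) :
  exists m (A : 'M[int]_(m, #|G|)), generates A (comm_lattice G).
Proof.
pose n := #|G|; pose P := comm_mx01 G.
exists #|{: 'I_n * 'I_n}|.
exists (\matrix_k (row (enum_val k).1 P - row (enum_val k).2 P)) => v.
have E (u : 'rV[int]_#|{: 'I_n * 'I_n}|) :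
    u *m (\matrix_k (row (enum_val k).1 P - row (enum_val k).2 P)) =
    \sum_i \sum_j u 0 (enum_rank (i, j)) *: (row i P - row j P).
  rewrite mulmx_sum_row pair_bigA /= (reindex (@enum_rank _)) /=; last first.
    by apply: onW_bij; exact: enum_rank_bij.
  by apply: eq_bigr => -[i j] _; rewrite rowK enum_rankK.
split=> [[c ->]|[u ->]].
  exists (\row_k c (enum_val k).1 (enum_val k).2); rewrite E.
  by apply: eq_bigr => i _; apply: eq_bigr => j _; rewrite mxE enum_rankK.
exists (\matrix_(i, j) u 0 (enum_rank (i, j))); rewrite E.
by apply: eq_bigr => i _; apply: eq_bigr => j _; rewrite mxE.
Qed.

Lemma comm_invariant_factors_exist (gT : finGroupType) (G : {group gT}) :
  exists d, invariant_factors (comm_lattice G) d.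
Proof.
have [m [A gA]] := comm_lattice_generated G.
by have [d dA] := smith_factors_exist A; exists d, m, A.
Qed.

(* Main.v *)
Require Import Defs.
From mathcomp Require Import all_boot all_order all_fingroup all_algebra all_solvable.

(** Whether two elements commute depends only on their classes modulo the
    centre, and an isoclinism matches the classes of [G] with those of [H] so
    that commuting pairs correspond to commuting pairs, since [beta] is
    injective and hence [~ g1, g2] = 1 iff [~ h1, h2] = 1.  Thus the two
    commuting matrices become equal, up to reordering, once repeated rows and
    columns are merged.

    Repeated rows do not change the lattice of row differences.  Repeated columns
    change the ambient group, but harmlessly: selecting columns along maps
    [s : H -> G] and [t : G -> H] of representatives carries each lattice into
    the other, and the two selections are mutually inverse on the lattices
    ([row_diff_lattice_transport], [row_diff_lattice_transportK]).

    Such a transport by integer matrices preserves the rank over every field,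
    because it turns generators into generators ([lattice_rank_transport]);
    this settles the conductor.  For the invariant factors it yields a
    factorisation [D = P *m E *m Q] of one Smith form through the other, and
    conversely.  A factorisation forces the k-th entry of [E] to divide the
    k-th entry of [D] ([smith_mx_factor_dvdn], indices from 0): modulo that
    entry of [E] at most [k] diagonal entries of [E] survive, so some unimodular
    combination of the first [k + 1] rows of [D] vanishes, and as these rows are
    diagonal with entries dividing the k-th one, that last entry vanishes too.
    Divisibility both ways makes the two lists of factors equal, so in
    particular their nontrivial parts agree. *)

Set Implicit Arguments.
Unset Strict Implicit.
Unset Printing Implicit Defensive.

Import Order.TTheory GRing.Theory Num.Theory.
Local Open Scope ring_scope.

(** * Divisibility between Smith forms *)

(** The last row of the Smith form of [A] vanishes, so the last row of the
    inverse of its left transition matrix kills [A]; being a row of an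
    invertible matrix, it is unimodular. *)
Lemma unimodular_left_kernel k (A : 'M[int]_(k.+1, k)) :
  exists (u : 'rV[int]_k.+1) (w : 'cV[int]_k.+1), u *m A = 0 /\ u *m w = 1%:M.
Proof.
have [L Lu [R _ [d _ ->]]] := int_Smith_normal_form A.
exists (row ord_max (invmx L)), (col ord_max L); split.
  rewrite -row_mul 2!mulmxA mulVmx // mul1mx row_mul.
  rewrite [X in X *m R](_ : _ = 0) ?mul0mx //; apply/rowP=> j.
  by rewrite !mxE /= gtn_eqF.
apply/matrixP=> i j; rewrite !ord1 mxE.
have /matrixP/(_ ord_max ord_max) := mulVmx Lu; rewrite !mxE eqxx => <-.
by apply: eq_bigr => l _; rewrite !mxE.
Qed.

Lemma dvdn_nth_sorted (e : seq nat) k l :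
  sorted dvdn e -> (k <= l)%N -> (nth 0 e k %| nth 0 e l)%N.
Proof.
move=> e_sorted le_kl; have [lt_l | le_l] := ltnP l (size e); last first.
  by rewrite (nth_default _ le_l) dvdn0.
apply: (sorted_leq_nth (fun _ _ _ => @dvdn_trans _ _ _) dvdnn) => //.
by rewrite inE (leq_ltn_trans le_kl).
Qed.

(** Write [D] and [E] for the Smith matrices of [d] and [e].
    Let [u] be a unimodular vector killing the first [k] columns of the first
    [k + 1] rows of [P].  The remaining columns meet entries of [E] that [e_k]
    divides, so [e_k] divides every entry [d_i * u_i] of the product of [u] with
    the leading block of [D], hence every [d_k * u_i] because [d_i] divides
    [d_k], and finally [d_k] because [u] is unimodular. *)
Lemma smith_mx_factor_dvdn m n m' n' (d e : seq nat)
    (P : 'M[int]_(m, m')) (Q : 'M[int]_(n', n)) k :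
    sorted dvdn d -> sorted dvdn e -> (size d <= minn m n)%N ->
    smith_mx m n d = P *m smith_mx m' n' e *m Q ->
  (nth 0 e k %| nth 0 d k)%N.
Proof.
move=> d_sorted e_sorted size_d factD.
have [lt_k | le_k] := ltnP k (size d); last by rewrite (nth_default _ le_k) dvdn0.
have /andP[lt_km lt_kn] : (k < m)%N && (k < n)%N.
  by rewrite -leq_min (leq_trans lt_k).
pose P1 := rowsub (widen_ord lt_km) P.
pose Q1 := colsub (widen_ord lt_kn) Q.
have blockE : diag_mx (\row_i (nth 0%N d i)%:Z) = P1 *m smith_mx m' n' e *m Q1.
  have -> : P1 *m smith_mx m' n' e *m Q1 =
            mxsub (widen_ord lt_km) (widen_ord lt_kn) (smith_mx m n d).
    by rewrite factD mxsub_mul -mul_rowsub_mx.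
  by apply/matrixP=> i j; rewrite !mxE.
(* The first k columns of P1, padded with zero columns when m' < k. *)
pose P2 := \matrix_(i < k.+1, j < k)
  (if insub (j : nat) is Some l then P1 i l else 0 : int).
have [u [w [uP2 uw]]] := unimodular_left_kernel P2.
have uP1_0 (l : 'I_m') : (l < k)%N -> (u *m P1) 0 l = 0.
  move=> lt_lk; have /matrixP/(_ 0 (Ordinal lt_lk)) := uP2; rewrite [RHS]mxE => <-.
  rewrite mxE [RHS]mxE; apply: eq_bigr => i _; congr (_ * _); rewrite [RHS]mxE /=.
  by case: insubP => [l' _ /val_inj-> | ]; rewrite ?ltn_ord.
have dvd_uPE j : ((nth 0%N e k)%:Z %| ((u *m (P1 *m smith_mx m' n' e)) 0 j)%R)%Z.
  rewrite mulmxA mxE; apply: rpred_sum => l _.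
  have [lt_lk | le_kl] := ltnP l k; first by rewrite uP1_0 // mul0r dvdz0.
  rewrite dvdz_mull // mxE; case: eqP => [_|_]; last by rewrite mulr0n dvdz0.
  by rewrite mulr1n; exact: dvdn_nth_sorted.
have dvd_du i : ((nth 0%N e k)%:Z %| (nth 0%N d k)%:Z * u 0%R i)%Z.
  apply: (@dvdz_trans (u 0 i * (nth 0%N d i)%:Z)).
    have -> : u 0 i * (nth 0%N d i)%:Z = (u *m (P1 *m smith_mx m' n' e *m Q1)) 0 i.
      by rewrite -blockE mul_mx_diag !mxE.
    by rewrite mulmxA mxE; apply: rpred_sum => l _; rewrite dvdz_mulr.
  by rewrite mulrC dvdz_mul //; apply: dvdn_nth_sorted; rewrite // -ltnS ltn_ord.
suff: ((nth 0%N e k)%:Z %| (nth 0%N d k)%:Z)%Z by [].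
have -> : (nth 0%N d k)%:Z = (nth 0%N d k)%:Z * (u *m w) 0 0.
  by rewrite uw mxE mulr1.
by rewrite mxE mulr_sumr; apply: rpred_sum => l _; rewrite mulrA dvdz_mulr.
Qed.

(** * Lattices identified by integer matrices *)

Section Transport.
Variables (N N' : nat) (M : 'rV[int]_N -> Prop) (M' : 'rV[int]_N' -> Prop).
Variables (A : 'M[int]_(N, N')) (B : 'M[int]_(N', N)).
Hypothesis MA : forall v, M v -> M' (v *m A).
Hypothesis MAK : forall v, M v -> v *m A *m B = v.

Lemma generates_row m (X : 'M[int]_(m, N)) i : generates X M -> M (row i X).
Proof. by move=> gX; apply/gX; exists (delta_mx 0 i); rewrite rowE. Qed.

Lemma generates_mulK m (X : 'M[int]_(m, N)) : generates X M -> X *m A *m B = X.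
Proof.
by move=> gX; apply/row_matrixP=> i; rewrite !row_mul MAK //; exact: generates_row.
Qed.

Lemma generates_mul_factor m m' (X : 'M[int]_(m, N)) (Y : 'M[int]_(m', N')) :
  generates X M -> generates Y M' -> exists U : 'M[int]_(m, m'), X *m A = U *m Y.
Proof.
move=> gX gY.
have /fin_all_exists[f fE] i : exists u : 'rV[int]_m', row i X *m A = u *m Y.
  by apply/gY/MA/generates_row.
exists (\matrix_i f i); apply/row_matrixP=> i.
by rewrite !row_mul rowK fE.
Qed.

(** Generators of [M] satisfy [X = X *m A *m B = U *m Y *m B], which exhibits the Smith
    form of [X] as a product through that of [Y]. *)
Lemma invariant_factors_dvdn d e k :
  invariant_factors M d -> invariant_factors M' e -> (nth 0 e k %| nth 0 d k)%N.
Proof.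
case=> m [X [gX [d_sorted _ size_d [L [R [Lu Ru XE]]]]]].
case=> m' [Y [gY [e_sorted _ _ [L' [R' [_ _ YE]]]]]].
have [U UE] := generates_mul_factor gX gY.
apply: (smith_mx_factor_dvdn (m := m) (n := N)
  (P := invmx L *m U *m L') (Q := R' *m B *m invmx R) k d_sorted e_sorted size_d).
have -> : smith_mx m N d = invmx L *m X *m invmx R.
  by rewrite XE !mulmxA mulVmx // mul1mx mulmxK.
by rewrite -{1}(generates_mulK gX) UE YE !mulmxA.
Qed.

Hypothesis MB : forall w, M' w -> M (w *m B).
Hypothesis MBK : forall w, M' w -> w *m B *m A = w.

(** [X *m A] generates [M'], and neither passing from [X] to [X *m A] nor
    returning by [B] can raise the rank over [F]. *)
Lemma lattice_rank_transport (F : fieldType) r :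
  lattice_rank F M r -> lattice_rank F M' r.
Proof.
case=> m [X [gX ->]]; exists m, (X *m A); split.
  move=> w; split=> [Mw | [u ->]]; last by rewrite mulmxA; apply/MA/gX; exists u.
  by have /gX[u uE] := MB Mw; exists u; rewrite mulmxA -uE MBK.
apply/eqP; rewrite eqn_leq; apply/andP; split.
  by rewrite -{1}(generates_mulK gX) (map_mxM (intmul 1)) mxrankM_maxl.
by rewrite (map_mxM (intmul 1)) mxrankM_maxl.
Qed.

End Transport.

(** The default value 0 lies outside both lists, so equal [nth] functions also
    force equal sizes. *)
Lemma eq_seq_nth_dvdn (d e : seq nat) :
    all (ltn 0) d -> all (ltn 0) e ->
    (forall k, nth 0 d k %| nth 0 e k)%N -> (forall k, nth 0 e k %| nth 0 d k)%N ->
  d = e.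
Proof.
move=> d_gt0 e_gt0 de ed.
have E k : nth 0%N d k = nth 0%N e k.
  by apply/eqP; rewrite eqn_dvd de ed.
have size_le (a b : seq nat) : all (ltn 0) a ->
    (forall k, nth 0%N a k = nth 0%N b k) -> (size a <= size b)%N.
  move=> /all_nthP a_gt0 ab; rewrite leqNgt; apply/negP => lt_ba.
  by have := a_gt0 0%N _ lt_ba; rewrite ab nth_default.
apply: (@eq_from_nth _ 0%N) => //.
by apply/eqP; rewrite eqn_leq !size_le.
Qed.

(** * Lattices of row differences *)

Definition row_diff_lattice n (A : 'M[int]_n) (v : 'rV[int]_n) : Prop :=
  exists c : 'M[int]_n, v = \sum_i \sum_j c i j *: (row i A - row j A).

Lemma row_diff_lattice0 n (A : 'M[int]_n) : row_diff_lattice A 0.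
Proof.
by exists 0; rewrite big1 // => i _; rewrite big1 // => j _; rewrite mxE scale0r.
Qed.

Lemma row_diff_latticeD n (A : 'M[int]_n) v w :
  row_diff_lattice A v -> row_diff_lattice A w -> row_diff_lattice A (v + w).
Proof.
move=> [c ->] [c' ->]; exists (c + c'); rewrite -big_split; apply: eq_bigr => i _.
by rewrite -big_split; apply: eq_bigr => j _; rewrite mxE scalerDl.
Qed.

Lemma row_diff_lattice_row n (A : 'M[int]_n) a i j :
  row_diff_lattice A (a *: (row i A - row j A)).
Proof.
exists (a *: delta_mx i j).
rewrite (bigD1 i) //= (bigD1 j) //= !mxE !eqxx mulr1 !big1 ?addr0 //.
- move=> l /negPf li; rewrite big1 // => k _.
  by rewrite !mxE li /= mulr0 scale0r.
- by move=> l /negPf lj; rewrite !mxE lj andbF mulr0 scale0r.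
Qed.

(** The matrix whose right action selects columns along [s]. *)
Definition colsel n n' (s : 'I_n' -> 'I_n) : 'M[int]_(n, n') := colsub s 1%:M.

Lemma mul_colsel m n n' (s : 'I_n' -> 'I_n) (v : 'M[int]_(m, n)) :
  v *m colsel s = colsub s v.
Proof. by rewrite mulmx_colsub mulmx1. Qed.

(** The index maps are asked to be adjoint rather than mutually inverse, since
    choices of representatives of classes are not bijective in general. *)
Section RowDifferences.
Variables (n n' : nat) (A : 'M[int]_n) (B : 'M[int]_n').
Variables (t : 'I_n -> 'I_n') (s : 'I_n' -> 'I_n).
Hypothesis adjoint_ts : forall i j, A i (s j) = B (t i) j.

Lemma row_diff_lattice_transport v :
  row_diff_lattice A v -> row_diff_lattice B (v *m colsel s).
Proof.
case=> c ->; rewrite mulmx_suml.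
apply: (big_ind _ (row_diff_lattice0 B) (@row_diff_latticeD _ B)) => i _.
rewrite mulmx_suml.
apply: (big_ind _ (row_diff_lattice0 B) (@row_diff_latticeD _ B)) => j _.
rewrite mul_colsel [X in row_diff_lattice B X](_ : _ =
  c i j *: (row (t i) B - row (t j) B)); first exact: row_diff_lattice_row.
by apply/rowP=> k; rewrite !mxE !adjoint_ts.
Qed.

Lemma row_diff_lattice_transportK v :
    (forall i j, A i (s (t j)) = A i j) ->
  row_diff_lattice A v -> v *m colsel s *m colsel t = v.
Proof.
move=> stK [c ->]; rewrite !mul_colsel; apply/rowP=> k; rewrite !mxE !summxE.
apply: eq_bigr => i _; rewrite !summxE; apply: eq_bigr => j _.
by rewrite !mxE !stK.
Qed.

End RowDifferences.

(** * Commuting matrices of isoclinic groups *)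

Lemma eq_mulg_comm (gT : finGroupType) (x y : gT) :
  (x * y == y * x)%g = ([~ x, y]%g == 1%g).
Proof. by apply/eqP/commgP. Qed.

Section Isoclinism.
Variables (gT hT : finGroupType) (G : {group gT}) (H : {group hT}).
Variables (alpha : {morphism (G / 'Z(G))%g >-> coset_of 'Z(H)}).
Variables (beta : {morphism (G^`(1))%g >-> hT}).
Hypothesis iso_ab : isoclinism alpha beta.

Let corr (g : gT) (h : hT) := alpha (coset 'Z(G) g) = coset 'Z(H) h.

Lemma isoclinism_commute g1 g2 h1 h2 :
    g1 \in G -> g2 \in G -> h1 \in H -> h2 \in H -> corr g1 h1 -> corr g2 h2 ->
  (g1 * g2 == g2 * g1)%g = (h1 * h2 == h2 * h1)%g.
Proof.
case: iso_ab => _ /isomP[inj_beta _] compat Gg1 Gg2 Hh1 Hh2 c1 c2.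
rewrite !eq_mulg_comm -(compat g1 g2 h1 h2) // morph_injm_eq1 //.
by rewrite /= derg1 mem_commg.
Qed.

Lemma isoclinism_corr_l g : g \in G -> exists2 h, h \in H & corr g h.
Proof.
case: iso_ab => /isomP[_ im_alpha] _ _ Gg.
have: alpha (coset 'Z(G) g) \in (H / 'Z(H))%g.
  by rewrite -im_alpha mem_morphim ?mem_quotient.
by case/morphimP=> h _ Hh E; exists h.
Qed.

Lemma isoclinism_corr_r h : h \in H -> exists2 g, g \in G & corr g h.
Proof.
case: iso_ab => /isomP[_ im_alpha] _ _ Hh.
have: coset 'Z(H) h \in (H / 'Z(H))%g by rewrite mem_quotient.
rewrite -im_alpha => /morphimP[_ _ /morphimP[g _ Gg ->] E].
by exists g.
Qed.

(** Representatives [t i] and [s j] of the corresponding classes.  They need not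
    be mutually inverse, but [s (t i)] lies in the class of [i] modulo the
    centre, so the commuting matrix does not distinguish the two. *)
Lemma isoclinism_comm_mx01 :
  exists (t : 'I_#|G| -> 'I_#|H|) (s : 'I_#|H| -> 'I_#|G|),
    [/\ forall i j, comm_mx01 G i (s j) = comm_mx01 H (t i) j,
        forall i j, comm_mx01 H i (t j) = comm_mx01 G (s i) j,
        forall i j, comm_mx01 G i (s (t j)) = comm_mx01 G i j
      & forall i j, comm_mx01 H i (t (s j)) = comm_mx01 H i j].
Proof.
pose R (i : 'I_#|G|) (j : 'I_#|H|) := corr (enum_val i) (enum_val j).
have RE i i' j j' : R i j -> R i' j' -> comm_mx01 G i i' = comm_mx01 H j j'.
  by move=> r r'; rewrite !mxE (isoclinism_commute _ _ _ _ r r') ?enum_valP.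
have /fin_all_exists[t Rt] i : exists j, R i j.
  have [h Hh c] := isoclinism_corr_l (enum_valP i).
  by exists (enum_rank_in Hh h); rewrite /R enum_rankK_in.
have /fin_all_exists[s Rs] j : exists i, R i j.
  have [g Gg c] := isoclinism_corr_r (enum_valP j).
  by exists (enum_rank_in Gg g); rewrite /R enum_rankK_in.
exists t, s; split=> i j; first exact: RE.
- by apply/esym/RE.
- by rewrite (RE _ _ _ _ (Rt i) (Rs (t j))); apply/esym/RE.
- by rewrite -(RE _ _ _ _ (Rs i) (Rt (s j))); exact: RE.
Qed.

End Isoclinism.

Theorem theorem4p3 (gT hT : finGroupType) (G : {group gT}) (H : {group hT}) :
  isoclinic G H ->
  (forall d e : seq nat,
     invariant_factors (comm_lattice G) d ->
     invariant_factors (comm_lattice H) e ->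
     nontrivial d = nontrivial e) /\
  (forall p : nat,
     conductor (comm_lattice G) p <-> conductor (comm_lattice H) p).
Proof.
case=> alpha [beta /isoclinism_comm_mx01[t [s [GH HG stK tsK]]]].
have MA := row_diff_lattice_transport GH.
have MB := row_diff_lattice_transport HG.
have MAK v := row_diff_lattice_transportK (v := v) stK.
have MBK v := row_diff_lattice_transportK (v := v) tsK.
split=> [d e factG factH | p].
  congr nontrivial; apply: eq_seq_nth_dvdn.
  - by case: factG => ? [? [_ []]].
  - by case: factH => ? [? [_ []]].
  - by move=> k; exact: (invariant_factors_dvdn MB MBK k factH factG).
  - by move=> k; exact: (invariant_factors_dvdn MA MAK k factG factH).
have rankGH F r := @lattice_rank_transport _ _ _ _ _ _ MA MAK MB MBK F r.
have rankHG F r := @lattice_rank_transport _ _ _ _ _ _ MB MBK MA MAK F r.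
split=> -[p_prime [r [r0 [rp rQ lt_r]]]]; split=> //; exists r, r0; split=> //.
- exact: rankGH.
- exact: rankGH.
- exact: rankHG.
- exact: rankHG.
Qed.
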